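(* Let $\mathcal{B}$ be a Krull–Schmidt exact category, and let $\mathcal{X},\mathcal{Y}$ be subcategories of $\mathcal{B}$. If $([\mathcal{X}],[\mathcal{Y}])$ is a complete ideal cotorsion pair in $\mathcal{B}$, then $(\mathcal{X},\mathcal{Y})$ is a complete cotorsion pair in $\mathcal{B}$.
   Context: $\mathcal{B}$ is an exact category in the sense of Quillen, with conflations $A\to B\to C$, inflations and deflations, and $\mathrm{Ext}^1(C,A)$ denotes the group of equivalence classes of conflations $A\to B\to C$. For $\delta\in\mathrm{Ext}^1(C,A)$, $a\colon A\to A'$ and $c\colon C'\to C$, $a_*\delta\in\mathrm{Ext}^1(C,A')$ is the pushout along $a$ and $c^*\delta\in\mathrm{Ext}^1(C',A)$ the pullback along $c$. For morphisms $i\colon A\to B$, $j\colon X\to Y$, $\mathrm{Ext}^1(i,j)\colon\mathrm{Ext}^1(B,X)\to\mathrm{Ext}^1(A,Y)$ is $\delta\mapsto j_*i^*\delta$. $\mathcal{B}$ is Krull–Schmidt if every object decomposes as a finite direct sum of indecomposable objects with local endomorphism rings (uniquely up to isomorphism and permutation of summands). **Complete cotorsion pairs.** A pair $(\mathcal{X},\mathcal{Y})$ of subcategories of $\mathcal{B}$ is a complete cotorsion pair if $\mathcal{X}$ and $\mathcal{Y}$ are closed under isomorphisms and direct summands and: (1) $\mathrm{Ext}^1(X,Y)=0$ for all $X\in\mathcal{X}$, $Y\in\mathcal{Y}$; (2) every $C\in\mathcal{B}$ admits a conflation $Y^C\to X^C\to C$ with $X^C\in\mathcal{X}$, $Y^C\in\mathcal{Y}$;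 (3) every $C\in\mathcal{B}$ admits a conflation $C\to Y_C\to X_C$ with $X_C\in\mathcal{X}$, $Y_C\in\mathcal{Y}$. **Ideals.** An ideal $\mathcal{I}$ of $\mathcal{B}$ is a collection of subgroups $\mathcal{I}(X,Y)\subseteq\mathrm{Hom}_{\mathcal{B}}(X,Y)$ closed under composition with arbitrary morphisms on both sides. For a subcategory $\mathcal{D}$, $[\mathcal{D}]$ is the class of all morphisms of $\mathcal{B}$ that factor through some object of $\mathcal{D}$. For an ideal $\mathcal{S}$, ${}^{\perp_1}\mathcal{S}=\{f\mid\mathrm{Ext}^1(f,s)=0\ \forall s\in\mathcal{S}\}$ and $\mathcal{S}^{\perp_1}=\{g\mid\mathrm{Ext}^1(s,g)=0\ \forall s\in\mathcal{S}\}$. **Complete ideal cotorsion pairs.** A special $\mathcal{I}$-precover of $M$ is a deflation $f\colon X\to M$ in $\mathcal{I}$ such that $f$ is the deflation of a conflation $K\to X\xrightarrow{f}M$ whose class is $h_*\lambda$ for some $\lambda\in\mathrm{Ext}^1(M,A)$ and some $h\colon A\to K$ in $\mathcal{I}^{\perp_1}$. Dually, a special $\mathcal{J}$-preenvelope of $M$ is an inflation $g\colon M\to Y$ in $\mathcal{J}$ such that $g$ is the inflation of a conflation $M\xrightarrow{g}Y\to C$ whose class is $h^*\delta$ for some $\delta\in\mathrm{Ext}^1(B,M)$ and some $h\colon C\to B$ in ${}^{\perp_1}\mathcal{J}$. $\mathcal{I}$ is special precovering (resp. $\mathcal{J}$ is special preenveloping) if every object has a special $\mathcal{I}$-precover (resp.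 special $\mathcal{J}$-preenvelope). A pair of ideals $(\mathcal{I},\mathcal{J})$ is an ideal cotorsion pair if $\mathcal{I}^{\perp_1}=\mathcal{J}$ and $\mathcal{I}={}^{\perp_1}\mathcal{J}$; it is complete if moreover $\mathcal{I}$ is special precovering and $\mathcal{J}$ is special preenveloping.
   Formalization: The subcategories X and Y are additionally assumed closed under isomorphisms and direct summands; without this the claim fails (vector spaces with split exact structure, X = Y = spaces of dimension at least 2). *)

(* Defs.v *)
From HB Require Import structures.
From mathcomp Require Import all_boot all_algebra generic_quotient.
From mathcomp Require Import boolp.

Set Implicit Arguments.
Unset Strict Implicit.
Unset Printing Implicit Defensive.

Import GRing.Theory.
Local Open Scope ring_scope.
Local Open Scope quotient_scope.

Reserved Notation "g \oc f" (at level 39, left associativity).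

Record preadditive := Preadditive {
  obj :> Type;
  hom : obj -> obj -> zmodType;
  idm : forall A, hom A A;
  comp : forall A B C, hom B C -> hom A B -> hom A C;
  compA : forall A B C D (h : hom C D) (g : hom B C) (f : hom A B),
    comp h (comp g f) = comp (comp h g) f;
  comp1m : forall A B (f : hom A B), comp (idm B) f = f;
  compm1 : forall A B (f : hom A B), comp f (idm A) = f;
  compDl : forall A B C (g g' : hom B C) (f : hom A B),
    comp (g + g') f = comp g f + comp g' f;
  compDr : forall A B C (g : hom B C) (f f' : hom A B),
    comp g (f + f') = comp g f + comp g f' }.

Arguments idm {p} A.
Arguments comp {p A B C} g f.
Notation "g \oc f" := (comp g f) : ring_scope.

Section Preadditive.
Variable B : preadditive.
Implicit Types A C X Y Z P : B.

Lemma comp0m X Y Z (f : hom X Y) : (0 : hom Y Z) \oc f = 0.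
Proof. by apply: (addrI ((0 : hom Y Z) \oc f)); rewrite -compDl !addr0. Qed.

Lemma compm0 X Y Z (g : hom Y Z) : g \oc (0 : hom X Y) = 0.
Proof. by apply: (addrI (g \oc (0 : hom X Y))); rewrite -compDr !addr0. Qed.

Lemma compNl X Y Z (g : hom Y Z) (f : hom X Y) : (- g) \oc f = - (g \oc f).
Proof. by apply: (addrI (g \oc f)); rewrite -compDl !subrr comp0m. Qed.

Lemma compNr X Y Z (g : hom Y Z) (f : hom X Y) : g \oc (- f) = - (g \oc f).
Proof. by apply: (addrI (g \oc f)); rewrite -compDr !subrr compm0. Qed.

Definition is_iso X Y (f : hom X Y) : Prop :=
  exists g : hom Y X, g \oc f = idm X /\ f \oc g = idm Y.

Definition isomorphic X Y : Prop := exists f : hom X Y, is_iso f.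

Definition zero_obj Z : Prop :=
  forall X, (forall f : hom Z X, f = 0) /\ (forall f : hom X Z, f = 0).

Definition biproduct_maps X Y P
    (i1 : hom X P) (i2 : hom Y P) (p1 : hom P X) (p2 : hom P Y) : Prop :=
  [/\ p1 \oc i1 = idm X, p2 \oc i2 = idm Y, p2 \oc i1 = 0, p1 \oc i2 = 0
    & i1 \oc p1 + i2 \oc p2 = idm P].

Definition is_biproduct X Y P : Prop :=
  exists i1 i2 p1 p2, @biproduct_maps X Y P i1 i2 p1 p2.

Definition is_direct_sum n (F : 'I_n -> B) P : Prop :=
  exists (inj : forall k, hom (F k) P) (prj : forall k, hom P (F k)),
    [/\ forall k, prj k \oc inj k = idm (F k),
        forall k l, k <> l -> prj l \oc inj k = 0
      & \sum_(k < n) inj k \oc prj k = idm P].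

Definition is_kernel X Y Z (i : hom X Y) (p : hom Y Z) : Prop :=
  p \oc i = 0 /\
  forall W (f : hom W Y), p \oc f = 0 -> exists! g : hom W X, i \oc g = f.

Definition is_cokernel X Y Z (i : hom X Y) (p : hom Y Z) : Prop :=
  p \oc i = 0 /\
  forall W (f : hom Y W), f \oc i = 0 -> exists! g : hom Z W, g \oc p = f.

Definition kernel_cokernel_pair X Y Z (i : hom X Y) (p : hom Y Z) : Prop :=
  is_kernel i p /\ is_cokernel i p.

(* [X --i--> E], [a : X -> X'], completed by [E --b--> E' <--i'-- X'] *)
Definition is_pushout X E X' E' (i : hom X E) (a : hom X X')
    (b : hom E E') (i' : hom X' E') : Prop :=
  b \oc i = i' \oc a /\
  forall W (u : hom E W) (v : hom X' W), u \oc i = v \oc a ->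
    exists! w : hom E' W, w \oc b = u /\ w \oc i' = v.

(* [E --p--> Z], [c : Z' -> Z], completed by [E <--b-- E' --p'--> Z'] *)
Definition is_pullback E Z Z' E' (p : hom E Z) (c : hom Z' Z)
    (b : hom E' E) (p' : hom E' Z') : Prop :=
  p \oc b = c \oc p' /\
  forall W (u : hom W E) (v : hom W Z'), p \oc u = c \oc v ->
    exists! w : hom W E', b \oc w = u /\ p' \oc w = v.

End Preadditive.

Record additive := Additive {
  additive_pre :> preadditive;
  has_zero : exists Z : additive_pre, zero_obj Z;
  has_biproducts : forall X Y : additive_pre, exists P, is_biproduct X Y P }.

Section Conflations.
Variables (B : additive)
  (conf : forall X Y Z : B, hom X Y -> hom Y Z -> Prop).

Definition inflation_of X Y (i : hom X Y) : Prop :=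
  exists Z (p : hom Y Z), conf i p.

Definition deflation_of Y Z (p : hom Y Z) : Prop :=
  exists X (i : hom X Y), conf i p.

(* Quillen's axioms, in Keller's and Buehler's form *)
Record exact_structure : Prop := ExactStructure {
  conf_kc : forall X Y Z (i : hom X Y) (p : hom Y Z),
    conf i p -> kernel_cokernel_pair i p;
  conf_iso : forall X Y Z X' Y' Z'
      (i : hom X Y) (p : hom Y Z) (i' : hom X' Y') (p' : hom Y' Z')
      (a : hom X X') (b : hom Y Y') (c : hom Z Z'),
    is_iso a -> is_iso b -> is_iso c ->
    b \oc i = i' \oc a -> c \oc p = p' \oc b -> conf i p -> conf i' p';
  infl_id : forall X, inflation_of (idm X);
  defl_id : forall X, deflation_of (idm X);
  infl_comp : forall X Y Z (j : hom Y Z) (i : hom X Y),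
    inflation_of i -> inflation_of j -> inflation_of (j \oc i);
  defl_comp : forall X Y Z (q : hom Y Z) (p : hom X Y),
    deflation_of p -> deflation_of q -> deflation_of (q \oc p);
  infl_pushout : forall X E X' (i : hom X E) (a : hom X X'),
    inflation_of i ->
    exists E' (b : hom E E') (i' : hom X' E'),
      is_pushout i a b i' /\ inflation_of i';
  defl_pullback : forall E Z Z' (p : hom E Z) (c : hom Z' Z),
    deflation_of p ->
    exists E' (b : hom E' E) (p' : hom E' Z'),
      is_pullback p c b p' /\ deflation_of p' }.

End Conflations.

Record exact_category := ExactCategory {
  exact_add :> additive;
  conflation : forall X Y Z : exact_add, hom X Y -> hom Y Z -> Prop;
  exactP : exact_structure conflation }.

Arguments conflation {e X Y Z} i p.

Section Exact.
Variable B : exact_category.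
Implicit Types A C X Y Z M : B.

Record extension C A := Extension {
  mid : B;
  infl : hom A mid;
  defl : hom mid C;
  extP : conflation infl defl }.

Definition ext_equiv C A (d d' : extension C A) : Prop :=
  exists b : hom (mid d) (mid d'),
    [/\ is_iso b, b \oc infl d = infl d' & defl d' \oc b = defl d].

Lemma ext_equiv_refl C A (d : extension C A) : ext_equiv d d.
Proof.
exists (idm _); split; rewrite ?comp1m ?compm1 //.
by exists (idm _); rewrite comp1m.
Qed.

Lemma ext_equiv_sym C A (d d' : extension C A) :
  ext_equiv d d' -> ext_equiv d' d.
Proof.
case=> b [[c [cb bc]] bi pb]; exists c; split; first by exists b.
- by rewrite -bi compA cb comp1m.
- by rewrite -pb -compA bc compm1.
Qed.

Lemma ext_equiv_trans C A (d d' d'' : extension C A) :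
  ext_equiv d d' -> ext_equiv d' d'' -> ext_equiv d d''.
Proof.
case=> b [[c [cb bc]] bi pb] [b' [[c' [cb' bc']] bi' pb']].
exists (b' \oc b); split.
- exists (c \oc c'); split.
  + by rewrite -compA (compA c') cb' comp1m cb.
  + by rewrite -compA (compA b) bc comp1m bc'.
- by rewrite -compA bi bi'.
- by rewrite compA pb' pb.
Qed.

Definition ext_equivb C A : rel {classic (extension C A)} :=
  fun d d' => `[< ext_equiv d d' >].

Lemma ext_equivb_equiv C A : equiv_class_of (@ext_equivb C A).
Proof.
split=> [d|d d'|d' d d''].
- exact/asboolP/ext_equiv_refl.
- by apply/idP/idP => /asboolP/ext_equiv_sym ?; apply/asboolP.
- by move=> /asboolP dd' /asboolP d'd''; apply/asboolP;
    exact: ext_equiv_trans dd' d'd''.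
Qed.

Canonical ext_equiv_rel C A := EquivRelPack (@ext_equivb_equiv C A).

Definition Ext1 C A : Type := {eq_quot (@ext_equiv_rel C A)}.

Definition ext_class C A (d : extension C A) : Ext1 C A :=
  \pi_({eq_quot (@ext_equiv_rel C A)}) (d : {classic (extension C A)}).

Definition ext_repr C A (x : Ext1 C A) : extension C A :=
  repr (x : {eq_quot (@ext_equiv_rel C A)}).

Lemma ext_reprK C A (x : Ext1 C A) : ext_class (ext_repr x) = x.
Proof. exact: reprK. Qed.

Lemma ext_classP C A (d d' : extension C A) :
  ext_class d = ext_class d' <-> ext_equiv d d'.
Proof.
split=> [/eqmodP/asboolP //|dd'].
exact/eqmodP/asboolP.
Qed.

Definition is_push C A A' (a : hom A A')
    (d : extension C A) (d' : extension C A') : Prop :=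
  exists b : hom (mid d) (mid d'),
    is_pushout (infl d) a b (infl d') /\ defl d' \oc b = defl d.

Definition is_pull C C' A (c : hom C' C)
    (d : extension C A) (d' : extension C' A) : Prop :=
  exists b : hom (mid d') (mid d),
    is_pullback (defl d) c b (defl d') /\ b \oc infl d' = infl d.

Lemma push_exists C A A' (a : hom A A') (d : extension C A) :
  exists d' : extension C A', is_push a d d'.
Proof.
case: d => E i p ip.
have [[pi0 _] [_ cokp]] := conf_kc (exactP B) ip.
have [|E' [b [i' [po [C0 [q i'q]]]]]] := infl_pushout (exactP B) (i := i) a.
  by exists C, p.
have [bi up] := po.
have [_ [qi0 cokq]] := conf_kc (exactP B) i'q.
have [|w [[wb wi] _]] := up _ p (0 : hom A' C); first by rewrite pi0 comp0m.
have up_uniq W (s s' : hom E' W) :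
    s \oc b = s' \oc b -> s \oc i' = s' \oc i' -> s = s'.
  move=> sb si.
  have [|z [_ zu]] := up _ (s \oc b) (s \oc i'); first by rewrite -!compA bi.
  by rewrite -(zu s) // (zu s').
have [t [tq _]] := cokq _ _ wi.
have [|s [sp _]] := cokp _ (q \oc b).
  by rewrite -compA bi compA qi0 comp0m.
have sw : s \oc w = q.
  by apply: up_uniq; rewrite -compA ?wb // wi compm0 qi0.
have [r [_ ru]] := cokp _ _ pi0.
have ts : t \oc s = idm C.
  rewrite -(ru (t \oc s)) ?(ru (idm C)) ?comp1m //.
  by rewrite -compA sp compA tq wb.
have [r' [_ ru']] := cokq _ _ qi0.
have st : s \oc t = idm C0.
  rewrite -(ru' (s \oc t)) ?(ru' (idm C0)) ?comp1m //.
  by rewrite -compA tq sw.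
have i'w : conflation i' w.
  apply: (conf_iso (exactP B) (a := idm A') (b := idm E') (c := t) _ _ _ _ _ i'q).
  - by exists (idm _); rewrite comp1m.
  - by exists (idm _); rewrite comp1m.
  - by exists s.
  - by rewrite comp1m compm1.
  - by rewrite compm1.
by exists (Extension i'w); exists b.
Qed.

Lemma pull_exists C C' A (c : hom C' C) (d : extension C A) :
  exists d' : extension C' A, is_pull c d d'.
Proof.
case: d => E i p ip.
have [[pi0 keri] _] := conf_kc (exactP B) ip.
have [|E' [b [p' [pb [A0 [j jp']]]]]] := defl_pullback (exactP B) (p := p) c.
  by exists A, i.
have [bp up] := pb.
have [[pj0 kerj] _] := conf_kc (exactP B) jp'.
have [|w [[bw pw] _]] := up _ i (0 : hom A C'); first by rewrite pi0 compm0.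
have up_uniq W (s s' : hom W E') :
    b \oc s = b \oc s' -> p' \oc s = p' \oc s' -> s = s'.
  move=> sb sp.
  have [|z [_ zu]] := up _ (b \oc s) (p' \oc s); first by rewrite !compA bp.
  by rewrite -(zu s) // (zu s').
have [t [jt _]] := kerj _ _ pw.
have [|s [is_ _]] := keri _ (b \oc j).
  by rewrite compA bp -compA pj0 compm0.
have ws : w \oc s = j.
  by apply: up_uniq; rewrite compA ?bw // pw comp0m pj0.
have [r [_ ru]] := keri _ _ pi0.
have st : s \oc t = idm A.
  rewrite -(ru (s \oc t)) ?(ru (idm A)) ?compm1 //.
  by rewrite compA is_ -compA jt bw.
have [r' [_ ru']] := kerj _ _ pj0.
have ts : t \oc s = idm A0.
  rewrite -(ru' (t \oc s)) ?(ru' (idm A0)) ?compm1 //.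
  by rewrite compA jt ws.
have wp' : conflation w p'.
  apply: (conf_iso (exactP B) (a := s) (b := idm E') (c := idm C') _ _ _ _ _ jp').
  - by exists t.
  - by exists (idm _); rewrite comp1m.
  - by exists (idm _); rewrite comp1m.
  - by rewrite comp1m ws.
  - by rewrite comp1m compm1.
by exists (Extension wp'); exists b.
Qed.

Lemma is_push_equiv C A A' (a : hom A A')
    (d1 d2 : extension C A) (e1 e2 : extension C A') :
  ext_equiv d1 d2 -> is_push a d1 e1 -> is_push a d2 e2 -> ext_equiv e1 e2.
Proof.
case=> t [[t' [t't tt']] ti pt] [b1 [[sq1 up1] pb1]] [b2 [[sq2 up2] pb2]].
have t'i : t' \oc infl d2 = infl d1 by rewrite -ti compA t't comp1m.
have uniq W (e : extension C A') (d : extension C A) (b : hom (mid d) (mid e))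
    (s s' : hom (mid e) W) : is_pushout (infl d) a b (infl e) ->
    s \oc b = s' \oc b -> s \oc infl e = s' \oc infl e -> s = s'.
  move=> [sq up] sb si.
  have [|z [_ zu]] := up _ (s \oc b) (s \oc infl e).
    by rewrite -!compA sq.
  by rewrite -(zu s) // (zu s').
have [|w [[wb wi] _]] := up1 _ (b2 \oc t) (infl e2).
  by rewrite -compA ti sq2.
have [|v [[vb vi] _]] := up2 _ (b1 \oc t') (infl e1).
  by rewrite -compA t'i sq1.
exists w; split=> //.
- exists v; split.
  + apply: (uniq _ _ _ b1) => //; rewrite comp1m -compA.
    * by rewrite wb compA vb -compA t't compm1.
    * by rewrite wi vi.
  + apply: (uniq _ _ _ b2) => //; rewrite comp1m -compA.
    * by rewrite vb compA wb -compA tt' compm1.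
    * by rewrite vi wi.
- apply: (uniq _ _ _ b1) => //; rewrite -compA.
  + by rewrite wb compA pb2 pt pb1.
  + rewrite wi.
    by rewrite (proj1 (proj1 (conf_kc (exactP B) (extP e2))))
               (proj1 (proj1 (conf_kc (exactP B) (extP e1)))).
Qed.

Lemma is_pull_equiv C C' A (c : hom C' C)
    (d1 d2 : extension C A) (e1 e2 : extension C' A) :
  ext_equiv d1 d2 -> is_pull c d1 e1 -> is_pull c d2 e2 -> ext_equiv e1 e2.
Proof.
case=> t [[t' [t't tt']] ti pt] [b1 [[sq1 up1] bi1]] [b2 [[sq2 up2] bi2]].
have pt' : defl d1 \oc t' = defl d2 by rewrite -pt -compA tt' compm1.
have t'i : t' \oc infl d2 = infl d1 by rewrite -ti compA t't comp1m.
have uniq W (e : extension C' A) (d : extension C A) (b : hom (mid e) (mid d))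
    (s s' : hom W (mid e)) : is_pullback (defl d) c b (defl e) ->
    b \oc s = b \oc s' -> defl e \oc s = defl e \oc s' -> s = s'.
  move=> [sq up] sb sp.
  have [|z [_ zu]] := up _ (b \oc s) (defl e \oc s).
    by rewrite !compA sq.
  by rewrite -(zu s) // (zu s').
have [|w [[bw pw] _]] := up2 _ (t \oc b1) (defl e1).
  by rewrite compA pt sq1.
have [|v [[bv pv] _]] := up1 _ (t' \oc b2) (defl e2).
  by rewrite compA pt' sq2.
exists w; split=> //.
- exists v; split.
  + apply: (uniq _ _ _ b1) => //; rewrite compm1 compA.
    * by rewrite bv -compA bw compA t't comp1m.
    * by rewrite pv pw.
  + apply: (uniq _ _ _ b2) => //; rewrite compm1 compA.
    * by rewrite bw -compA bv compA tt' comp1m.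
    * by rewrite pw pv.
- apply: (uniq _ _ _ b2) => //; rewrite compA.
  + by rewrite bw -compA bi1 ti bi2.
  + rewrite pw.
    by rewrite (proj1 (proj1 (conf_kc (exactP B) (extP e1))))
               (proj1 (proj1 (conf_kc (exactP B) (extP e2)))).
Qed.

Definition push C A A' (a : hom A A') (x : Ext1 C A) : Ext1 C A' :=
  ext_class (sval (cid (push_exists a (ext_repr x)))).

Definition pull C C' A (c : hom C' C) (x : Ext1 C A) : Ext1 C' A :=
  ext_class (sval (cid (pull_exists c (ext_repr x)))).

Lemma pushE C A A' (a : hom A A') (d : extension C A) (d' : extension C A') :
  is_push a d d' -> push a (ext_class d) = ext_class d'.
Proof.
move=> dd'; apply/ext_classP.
case: cid => e /= pe; apply: is_push_equiv pe dd'.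
exact/ext_classP/ext_reprK.
Qed.

Lemma pullE C C' A (c : hom C' C) (d : extension C A) (d' : extension C' A) :
  is_pull c d d' -> pull c (ext_class d) = ext_class d'.
Proof.
move=> dd'; apply/ext_classP.
case: cid => e /= pe; apply: is_pull_equiv pe dd'.
exact/ext_classP/ext_reprK.
Qed.

Definition Ext1map A A' X Y (i : hom A A') (j : hom X Y) (x : Ext1 A' X) :
  Ext1 A Y := push j (pull i x).

Lemma split_conflation A C P (i1 : hom A P) (i2 : hom C P)
    (p1 : hom P A) (p2 : hom P C) :
  biproduct_maps i1 i2 p1 p2 -> conflation i1 p2.
Proof.
case=> p1i1 p2i2 p2i1 p1i2 sum1.
have [K [k kid]] := defl_id (exactP B) C.
have [d' [b [[sq _] pb]]] := push_exists (0 : hom K A) (Extension kid).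
rewrite /= in b sq pb; case: d' b sq pb => E i p ip /= b sq pb.
have [[pi0 keri] [_ cokp]] := conf_kc (exactP B) ip.
have [|r [ir _]] := keri _ (idm E - b \oc p).
  by rewrite compDr compNr compm1 compA pb comp1m subrr.
have inj W (s s' : hom W A) : i \oc s = i \oc s' -> s = s'.
  move=> ss'; have [|z [_ zu]] := keri _ (i \oc s).
    by rewrite compA pi0 comp0m.
  by rewrite -(zu s) // (zu s').
have ri : r \oc i = idm A.
  apply: inj.
  by rewrite compA ir compDl compNl comp1m -compA pi0 !compm0 subr0 compm1.
have rb : r \oc b = 0.
  by apply: inj; rewrite compA ir compDl compNl comp1m -compA pb compm1 subrr compm0.
apply: (conf_iso (exactP B) (a := idm A) (b := i1 \oc r + i2 \oc p)
                 (c := idm C) _ _ _ _ _ ip).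
- by exists (idm _); rewrite comp1m.
- exists (i \oc p1 + b \oc p2); split.
  + rewrite compDl !compDr !compA.
    rewrite -(compA i p1 i1) -(compA i p1 i2) -(compA b p2 i1) -(compA b p2 i2).
    rewrite p1i1 p1i2 p2i1 p2i2 !compm0 !comp0m !compm1 addr0 add0r ir.
    by rewrite subrK.
  + rewrite compDl !compDr !compA.
    rewrite -(compA i1 r i) -(compA i1 r b) -(compA i2 p i) -(compA i2 p b).
    by rewrite ri rb pi0 pb !compm0 !comp0m !compm1 addr0 add0r sum1.
- by exists (idm _); rewrite comp1m.
- by rewrite compm1 compDl -!compA ri pi0 compm1 compm0 addr0.
- by rewrite comp1m compDr !compA p2i1 p2i2 comp0m comp1m add0r.
Qed.

Lemma split_exists C A :
  exists d : extension C A, exists s : hom C (mid d), defl d \oc s = idm C.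
Proof.
have [P [i1 [i2 [p1 [p2 bp]]]]] := has_biproducts A C.
exists (Extension (split_conflation bp)); exists i2.
by case: bp.
Qed.

(* the neutral element of the group [Ext1 C A]: the class of the split
   conflation *)
Definition Ext1_zero C A : Ext1 C A := ext_class (sval (cid (split_exists C A))).

Lemma Ext1_zeroP C A (d : extension C A) :
  ext_class d = Ext1_zero C A <->
  exists s : hom C (mid d), defl d \oc s = idm C.
Proof.
split=> [/ext_classP|].
  case: cid => d0 /= [s ps] [b [[c [cb bc]] _ pb]]; exists (c \oc s).
  by rewrite -pb -compA (compA b) bc comp1m ps.
move=> [s ps]; apply/ext_classP; case: cid => d0 /= [s0 ps0].
have retr (e : extension C A) (t : hom C (mid e)) : defl e \oc t = idm C ->
    exists r : hom (mid e) A, [/\ r \oc infl e = idm A, r \oc t = 0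
      & infl e \oc r + t \oc defl e = idm (mid e)].
  have [[pi0 keri] _] := conf_kc (exactP B) (extP e).
  move=> pt; have [|r [ir _]] := keri _ (idm _ - t \oc defl e).
    by rewrite compDr compNr compm1 compA pt comp1m subrr.
  have inj W (u u' : hom W A) : infl e \oc u = infl e \oc u' -> u = u'.
    move=> uu'; have [|z [_ zu]] := keri _ (infl e \oc u).
      by rewrite compA pi0 comp0m.
    by rewrite -(zu u) // (zu u').
  exists r; split; last by rewrite ir subrK.
  - apply: inj.
    by rewrite compA ir compDl compNl comp1m -compA pi0 !compm0 subr0 compm1.
  - apply: inj.
    by rewrite compA ir compDl compNl comp1m -compA pt compm1 subrr compm0.
have [r [ri rs sum1]] := retr _ _ ps.
have [r0 [ri0 rs0 sum10]] := retr _ _ ps0.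
have pi0 := proj1 (proj1 (conf_kc (exactP B) (extP d))).
have pi00 := proj1 (proj1 (conf_kc (exactP B) (extP d0))).
exists (infl d0 \oc r + s0 \oc defl d); split.
- exists (infl d \oc r0 + s \oc defl d0); split.
  + rewrite compDl !compDr !compA -!(compA _ r0) -!(compA _ (defl d0)).
    by rewrite ri0 rs0 pi00 ps0 !compm1 !compm0 !comp0m addr0 add0r.
  + rewrite compDl !compDr !compA -!(compA _ r) -!(compA _ (defl d)).
    by rewrite ri rs pi0 ps !compm1 !compm0 !comp0m addr0 add0r.
- by rewrite compDl -!compA ri pi0 compm1 compm0 addr0.
- by rewrite compDr !compA pi00 ps0 comp0m comp1m add0r.
Qed.

Definition indecomposable A : Prop :=
  ~ zero_obj A /\
  forall A1 A2, is_biproduct A1 A2 A -> zero_obj A1 \/ zero_obj A2.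

(* the endomorphism ring is nonzero and its non-units are closed under sums *)
Definition local_end A : Prop :=
  idm A <> 0 /\
  forall f g : hom A A, is_iso (f + g) -> is_iso f \/ is_iso g.

Definition KS_decomposition n (F : 'I_n -> B) A : Prop :=
  (forall k, indecomposable (F k) /\ local_end (F k)) /\ is_direct_sum F A.

Definition Krull_Schmidt : Prop :=
  forall A,
    (exists n (F : 'I_n -> B), KS_decomposition F A) /\
    (forall n m (F : 'I_n -> B) (G : 'I_m -> B),
      KS_decomposition F A -> KS_decomposition G A ->
      exists2 s : 'I_n -> 'I_m, bijective s & forall k, isomorphic (F k) (G (s k))).

(* Below, a full subcategory is represented by its class of objects
   [X : B -> Prop]. *)

Definition iso_closed (X : B -> Prop) : Prop :=
  forall A A', isomorphic A A' -> X A -> X A'.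

Definition summand_closed (X : B -> Prop) : Prop :=
  forall A1 A2 A, is_biproduct A1 A2 A -> X A -> X A1.

Record complete_cotorsion_pair (X Y : B -> Prop) : Prop := {
  ccp_isoX : iso_closed X;
  ccp_isoY : iso_closed Y;
  ccp_summandX : summand_closed X;
  ccp_summandY : summand_closed Y;
  ccp_ext : forall C A, X C -> Y A -> forall x : Ext1 C A, x = Ext1_zero C A;
  ccp_precover : forall C, exists YC XC (i : hom YC XC) (p : hom XC C),
    [/\ conflation i p, X XC & Y YC];
  ccp_preenvelope : forall C, exists YC XC (i : hom C YC) (p : hom YC XC),
    [/\ conflation i p, X XC & Y YC] }.

Definition mor_class : Type := forall A A' : B, hom A A' -> Prop.

Record is_ideal (I : mor_class) : Prop := {
  ideal0 : forall A A', I A A' 0;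
  idealB : forall A A' (f g : hom A A'), I _ _ f -> I _ _ g -> I _ _ (f - g);
  idealMl : forall A A' A'' (g : hom A' A'') (f : hom A A'),
    I _ _ f -> I _ _ (g \oc f);
  idealMr : forall A A' A'' (g : hom A' A'') (f : hom A A'),
    I _ _ g -> I _ _ (g \oc f) }.

Definition factor_class (D : B -> Prop) : mor_class := fun A A' f =>
  exists Z (g : hom Z A') (h : hom A Z), D Z /\ f = g \oc h.

Definition Ext1map_zero A A' X Y (i : hom A A') (j : hom X Y) : Prop :=
  forall x : Ext1 A' X, Ext1map i j x = Ext1_zero A Y.

Definition left_perp (S : mor_class) : mor_class := fun A A' f =>
  forall X Y (s : hom X Y), S _ _ s -> Ext1map_zero f s.

Definition right_perp (S : mor_class) : mor_class := fun X Y g =>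
  forall A A' (s : hom A A'), S _ _ s -> Ext1map_zero s g.

Definition special_precover (I : mor_class) X M (f : hom X M) : Prop :=
  I _ _ f /\
  exists K (k : hom K X) (kf : conflation k f) A (l : Ext1 M A) (h : hom A K),
    right_perp I h /\ ext_class (Extension kf) = push h l.

Definition special_preenvelope (J : mor_class) M Y (g : hom M Y) : Prop :=
  J _ _ g /\
  exists C (q : hom Y C) (gq : conflation g q) D (l : Ext1 D M) (h : hom C D),
    left_perp J h /\ ext_class (Extension gq) = pull h l.

Definition special_precovering (I : mor_class) : Prop :=
  forall M, exists X (f : hom X M), special_precover I f.

Definition special_preenveloping (J : mor_class) : Prop :=
  forall M, exists Y (g : hom M Y), special_preenvelope J g.

Definition ideal_cotorsion_pair (I J : mor_class) : Prop :=
  [/\ is_ideal I, is_ideal J,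
      forall X Y (g : hom X Y), right_perp I g <-> J _ _ g
    & forall A A' (f : hom A A'), I _ _ f <-> left_perp J f].

Definition complete_ideal_cotorsion_pair (I J : mor_class) : Prop :=
  [/\ ideal_cotorsion_pair I J, special_precovering I
    & special_preenveloping J].

End Exact.

Arguments Krull_Schmidt : clear implicits.

(* Main.v *)
(* A special [X]-precover of C yields a conflation Y0 -> E -> C with Y0 in Y
   and an endomorphism f of E over C that factors through X. If f is invertible,
   then E is a retract, hence (in a Krull-Schmidt category) a summand, of an
   object of X. Otherwise 1 - f is not in the radical, so some local object L is
   split off by 1 - f; as p (1 - f) = 0, it splits off from both E and Y0, and
   one removes it and inducts on the number of local summands of E. The
   preenvelopes are obtained in the opposite exact category. *)
From mathcomp Require Import all_boot all_algebra boolp.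
Require Import Defs.

Set Implicit Arguments.
Unset Strict Implicit.
Unset Printing Implicit Defensive.

Import GRing.Theory.
Local Open Scope ring_scope.

Lemma addr_subBB (V : zmodType) (x y z : V) : x + (z - y - (x - y)) = z.
Proof. by rewrite opprB [LHS]addrC -addrA subrK subrK. Qed.

(** * Biproducts and Schur complements in a preadditive category *)

Section Preadditive.
Variable B : preadditive.
Implicit Types A C E L M P R W : B.

Lemma compBl A C E (g g' : hom C E) (f : hom A C) :
  (g - g') \oc f = g \oc f - g' \oc f.
Proof. by rewrite compDl compNl. Qed.

Lemma compBr A C E (g : hom C E) (f f' : hom A C) :
  g \oc (f - f') = g \oc f - g \oc f'.
Proof. by rewrite compDr compNr. Qed.

Lemma comp_sumr A C E n (g : hom C E) (f : 'I_n -> hom A C) :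
  g \oc (\sum_(k < n) f k) = \sum_(k < n) g \oc f k.
Proof. exact: (big_morph (comp g) (compDr g) (compm0 _ g)). Qed.

Lemma comp_suml A C E n (g : 'I_n -> hom C E) (f : hom A C) :
  (\sum_(k < n) g k) \oc f = \sum_(k < n) g k \oc f.
Proof.
exact: (big_morph (fun h => comp h f) (fun h h' => compDl h h' f) (comp0m _ f)).
Qed.

Lemma biproduct_mapsI A C P
    (i1 : hom A P) (i2 : hom C P) (p1 : hom P A) (p2 : hom P C) :
  p1 \oc i1 = idm A -> p2 \oc i2 = idm C -> i1 \oc p1 + i2 \oc p2 = idm P ->
  biproduct_maps i1 i2 p1 p2.
Proof.
move=> pi1 pi2 ip; split=> //.
- have := congr1 (fun f => p2 \oc f \oc i1) ip.
  rewrite /= compm1 compDr compDl !compA pi2 comp1m -!compA pi1 compm1.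
  by rewrite -[RHS]addr0 => /addrI.
- have := congr1 (fun f => p1 \oc f \oc i2) ip.
  rewrite /= compm1 compDr compDl !compA pi1 comp1m -!compA pi2 compm1.
  by rewrite -[RHS]addr0 => /addrI.
Qed.

Lemma biproduct_mapsC A C P
    (i1 : hom A P) (i2 : hom C P) (p1 : hom P A) (p2 : hom P C) :
  biproduct_maps i1 i2 p1 p2 -> biproduct_maps i2 i1 p2 p1.
Proof. by case=> ? ? ? ? ?; split=> //; rewrite addrC. Qed.

Lemma biproduct_projr A C P
    (i1 : hom A P) (i2 : hom C P) (p1 : hom P A) (p2 : hom P C) :
  biproduct_maps i1 i2 p1 p2 -> i2 \oc p2 = idm P - i1 \oc p1.
Proof. by case=> _ _ _ _ <-; rewrite addrAC subrr add0r. Qed.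

(** The projector [1 - i1 q1] moves [i2] into the kernel of [q1], so a prescribed retraction can
    serve as the projection. *)
Lemma biproduct_retraction A C P
    (i1 : hom A P) (i2 : hom C P) (p1 q1 : hom P A) (p2 : hom P C) :
  biproduct_maps i1 i2 p1 p2 -> q1 \oc i1 = idm A ->
  biproduct_maps i1 (i2 - i1 \oc q1 \oc i2) q1 p2.
Proof.
move=> bip qi; have e2 := biproduct_projr bip.
case: bip => pi1 pi2 p2i1 p1i2 ip.
apply: biproduct_mapsI => //.
- by rewrite compBr !compA p2i1 !comp0m pi2 subr0.
- rewrite compBl -(compA _ i2) e2 compBr compm1 -!compA (compA q1) qi comp1m.
  exact: addr_subBB.
Qed.

Lemma is_iso_id A : is_iso (idm A).
Proof. by exists (idm A); rewrite comp1m. Qed.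

(** Block elimination: [v] is a right inverse of the corner of [f] on [A], and [t] one of its Schur
    complement. *)
Lemma schur_rinv A C P (i1 : hom A P) (i2 : hom C P) (p1 : hom P A)
    (p2 : hom P C) (f : hom P P) (v : hom A A) (t : hom C C) :
  biproduct_maps i1 i2 p1 p2 -> p1 \oc f \oc i1 \oc v = idm A ->
  (p2 \oc f \oc i2 - p2 \oc f \oc i1 \oc v \oc p1 \oc f \oc i2) \oc t = idm C ->
  exists g : hom P P, f \oc g = idm P.
Proof.
case=> _ _ _ _ ip uv; set s := _ - _ => st.
pose g := i2 - i1 \oc v \oc p1 \oc f \oc i2.
pose h := p2 - p2 \oc f \oc i1 \oc v \oc p1.
have fg : f \oc g = i2 \oc s.
  have p1fg : p1 \oc f \oc g = 0 by rewrite compBr !compA uv comp1m subrr.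
  have p2fg : p2 \oc f \oc g = s by rewrite compBr !compA.
  rewrite -[f]comp1m -ip compDl compDl -!compA (compA p1) (compA p2).
  by rewrite p1fg p2fg compm0 add0r.
have fi1 : f \oc i1 \oc v = i1 + i2 \oc p2 \oc f \oc i1 \oc v.
  rewrite -[in LHS](comp1m f) -ip !compDl -(compA i1) -(compA i1) -(compA i1) uv.
  by rewrite compm1.
(* Under [f] the first term becomes [i1 p1] plus an error in [C]; by [f g = i2 s] and [s t = 1] the
   second becomes [i2 h], that is [i2 p2] minus this error. *)
exists (i1 \oc v \oc p1 + g \oc t \oc h).
rewrite compDr !compA fg fi1 -(compA i2 s) st compm1 compBr compDl !compA.
by rewrite addrACA subrr addr0.
Qed.

End Preadditive.

Definition op_preadditive (B : preadditive) : preadditive.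
Proof.
refine (@Preadditive B (fun A C => hom C A) (@idm B)
  (fun A C E g f => f \oc g) _ _ _ _ _).
- by move=> *; rewrite compA.
- by move=> *; rewrite compm1.
- by move=> *; rewrite comp1m.
- by move=> *; rewrite compDr.
- by move=> *; rewrite compDl.
Defined.

(* Passing to the opposite category turns the right inverse
   of [schur_rinv] into a left one. *)
Lemma schur_iso (B : preadditive) (A C P : B) (i1 : hom A P) (i2 : hom C P)
    (p1 : hom P A) (p2 : hom P C) (f : hom P P) (v : hom A A) :
  biproduct_maps i1 i2 p1 p2 ->
  v \oc (p1 \oc f \oc i1) = idm A -> p1 \oc f \oc i1 \oc v = idm A ->
  is_iso (p2 \oc f \oc i2 - p2 \oc f \oc i1 \oc v \oc p1 \oc f \oc i2) ->
  is_iso f.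
Proof.
move=> bip vu uv [t [ts st]].
have [g fg] := schur_rinv bip uv st.
have [g' g'f] : exists g' : hom P P, g' \oc f = idm P.
  apply: (@schur_rinv (op_preadditive B) A C P p1 p2 i1 i2 f v t).
  - by case: bip.
  - by move: vu; rewrite /= !compA.
  - by move: ts; rewrite /= !compA.
by exists g; split=> //; rewrite -[g]comp1m -{1}g'f -(compA g') fg compm1.
Qed.

(** * Local objects, the radical and finite sums of local objects *)

Section Krull_Schmidt.
Variable B : exact_category.
Implicit Types A C E L M P R W : B.

(* A local endomorphism ring has only the idempotents 0 and 1. *)
Lemma local_retract_iso L M (a : hom L M) (b : hom M L) :
  local_end L -> local_end M -> is_iso (b \oc a) ->
  exists v : hom M L, v \oc a = idm L /\ a \oc v = idm M.
Proof.
move=> [nzL _] [_ locM] [w [wba _]].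
set v := w \oc b; have va : v \oc a = idm L by rewrite -compA.
exists v; split=> //; set e := a \oc v.
have ee : e \oc e = e by rewrite /e -compA (compA v) va comp1m.
(* One of [e] and [1 - e] is invertible; an invertible idempotent is [1], and [e = 0] would force
   [idm L = 0]. *)
have [|[e' [e'e _]]|[e' [_ ee']]] := locM e (idm M - e).
- by rewrite addrC subrK; apply: is_iso_id.
- by rewrite -[LHS]comp1m -e'e -compA ee.
- have e0 : e = 0.
    by rewrite -[LHS]compm1 -ee' compA compBr compm1 ee subrr comp0m.
  by case: nzL; rewrite -va -[v]comp1m -{1}va -(compA v) -/e e0 compm0 comp0m.
Qed.

(** In a Krull-Schmidt category this is the Jacobson radical of the category, tested on local
    objects. *)
Definition radical A C (f : hom A C) : Prop :=
  forall L (a : hom L A) (b : hom C L), local_end L -> ~ is_iso (b \oc f \oc a).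

Lemma radicalD A C (f g : hom A C) : radical f -> radical g -> radical (f + g).
Proof.
move=> rf rg L a b locL; rewrite compDr compDl => /(proj2 locL) [].
- exact: rf.
- exact: rg.
Qed.

Lemma radical_comp A C E P (h : hom E P) (f : hom C E) (g : hom A C) :
  radical f -> radical (h \oc f \oc g).
Proof. by move=> rf L a b locL; rewrite !compA -(compA _ g); apply: rf. Qed.

(** Peeling off one local summand at a time allows induction on their number; [idm E = 0] says that
    [E] is a zero object. *)
Fixpoint local_sum n E : Prop :=
  if n is m.+1 then
    exists L E', [/\ local_end L, local_sum m E' & is_biproduct L E' E]
  else idm E = 0.

(** The corner of [f] on a local summand is not invertible, so that of [1 - f] is; the Schur
    complement is again [1] minus a radical map, on an object with one local summand fewer. *)
Lemma radical_iso n E (f : hom E E) :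
  local_sum n E -> radical f -> is_iso (idm E - f).
Proof.
elim: n E f => [|n IHn] E f /=.
  move=> E0 _; exists 0; have z (g : hom E E) : g = 0.
    by rewrite -[g]comp1m E0 comp0m.
  by rewrite [idm E]z comp0m compm0.
move=> [L [E' [locL sE' [i1 [i2 [p1 [p2 bip]]]]]]] rf.
have [pi1 pi2 p2i1 p1i2 ip] := bip.
set g := idm E - f.
have [|[v [vu uv]]|/rf //] := proj2 locL (p1 \oc g \oc i1) (p1 \oc f \oc i1).
  rewrite -compDl -compDr subrK compm1 pi1; exact: is_iso_id.
apply: (schur_iso bip vu uv).
have g21 : p2 \oc g \oc i1 = - (p2 \oc f \oc i1).
  by rewrite compBr compBl compm1 p2i1 sub0r.
have g12 : p1 \oc g \oc i2 = - (p1 \oc f \oc i2).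
  by rewrite compBr compBl compm1 p1i2 sub0r.
rewrite g21 -(compA _ p1 g) -(compA _ (p1 \oc g) i2) g12.
rewrite compNr !compNl opprK compBr compBl compm1 pi2 -addrA -opprD.
apply: IHn => //; apply: radicalD; first exact: radical_comp.
rewrite -!compA compA; exact: radical_comp.
Qed.

(** Exchange property: the identity of [L] is the sum of its paths through one local summand of [E]
    and through the rest, and one path is invertible. *)
Lemma local_sum_summand n E L (a : hom L E) (b : hom E L) :
  local_end L -> local_sum n E -> b \oc a = idm L ->
  exists m E' (j : hom E' E) (q : hom E E'),
    [/\ n = m.+1, local_sum m E' & biproduct_maps a j b q].
Proof.
move=> locL sE ba.
(* Any projection [b'] will do: [biproduct_retraction] restores [b] by changing [j]. *)
suff [m [E' [j [q [b' [-> sE' bip]]]]]] : exists m E' (j : hom E' E)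
    (q : hom E E') b', [/\ n = m.+1, local_sum m E' & biproduct_maps a j b' q].
  by exists m, E', (j - a \oc b \oc j), q; split=> //; exact: biproduct_retraction bip ba.
elim: n E a b sE ba => [|n IHn] E a b /=.
  move=> E0 ba; case: (proj1 locL).
  by rewrite -ba -[a]comp1m E0 comp0m compm0.
move=> [M [E1 [locM sE1 [i1 [i2 [p1 [p2 bip]]]]]]] ba.
have [pi1 pi2 p2i1 p1i2 ip] := bip.
have [||] := proj2 locL (b \oc i1 \oc (p1 \oc a)) (b \oc i2 \oc (p2 \oc a)).
- rewrite -!(compA b) -compDr !compA -compDl ip comp1m ba; exact: is_iso_id.
(* Path through [M]: [p1 a] is an isomorphism, so [L] replaces [M] and the complement stays [E1]. *)
- move=> /(local_retract_iso locL locM)[v [va av]].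
  exists n, E1, i2, (p2 - p2 \oc a \oc v \oc p1), (v \oc p1).
  split=> //; apply: biproduct_mapsI.
  + by rewrite -compA.
  + by rewrite compBl -compA p1i2 compm0 subr0.
  + rewrite compBr !compA (biproduct_projr bip) !compBl comp1m.
    rewrite -(compA i1 p1 a) -(compA i1 _ v) av compm1; exact: addr_subBB.
(* Path through [E1]: by induction [L] splits off [E1], leaving [E2]; the new complement is the sum
   of [M] and [E2]. *)
- move=> [w [wba _]].
  have [|m [E2 [j [q [b' [-> sE2 bip2]]]]]] :=
      IHn E1 (p2 \oc a) (w \oc b \oc i2) sE1.
    by rewrite -wba !compA.
  have [P [a1 [a2 [b1 [b2 bipP]]]]] := has_biproducts M E2.
  have [ba1 ba2 b2a1 b1a2 abP] := bipP; have [b'a qj _ b'j _] := bip2.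
  (* [c], [x], [y] are the projections onto [L], [M], [E2] matching the inclusions [a], [i1],
     [i2 j]; [x] is [p1] corrected to kill [a]. *)
  pose c := b' \oc p2; pose y := q \oc p2.
  have ca : c \oc a = idm L by rewrite -compA.
  have ci1 : c \oc i1 = 0 by rewrite -compA p2i1 compm0.
  have cj : c \oc (i2 \oc j) = 0.
    by rewrite -compA (compA p2) pi2 comp1m.
  have yi1 : y \oc i1 = 0 by rewrite -compA p2i1 compm0.
  have yj : y \oc (i2 \oc j) = idm E2.
    by rewrite -compA (compA p2) pi2 comp1m qj.
  have jy : i2 \oc j \oc y = i2 \oc p2 - i2 \oc p2 \oc a \oc c.
    rewrite /y !compA -(compA i2) (biproduct_projr bip2).
    by rewrite compBr compm1 compBl /c !compA.
  clearbody c y; pose x := p1 - p1 \oc a \oc c.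
  have xi1 : x \oc i1 = idm M by rewrite compBl pi1 -compA ci1 compm0 subr0.
  have xj : x \oc (i2 \oc j) = 0.
    by rewrite compBl -[_ \oc c \oc _]compA cj compA p1i2 comp0m compm0 subr0.
  have sum1 : a \oc c + (i1 \oc x + i2 \oc j \oc y) = idm E.
    rewrite jy compBr addrACA ip -opprD !compA -!compDl ip comp1m.
    by rewrite [LHS]addrC subrK.
  clearbody x.
  exists m.+1, P, (i1 \oc b1 + i2 \oc j \oc b2), (a1 \oc x + a2 \oc y), c.
  split=> //; first by exists M, E2; split=> //; exists a1, a2, b1, b2.
  apply: biproduct_mapsI.
  + by [].
  + rewrite compDl !compDr -!(compA a1) -!(compA a2).
    rewrite (compA x i1) (compA y i1) !(compA _ (i2 \oc j)) xi1 xj yi1 yj.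
    by rewrite !comp0m !comp1m compm0 compm0 addr0 add0r.
  + rewrite compDl !compDr -!(compA i1) -!(compA (i2 \oc j)).
    rewrite (compA b1) (compA b1) (compA b2) (compA b2) ba1 ba2 b2a1 b1a2.
    by rewrite !comp0m !comp1m compm0 compm0 addr0 add0r.
Qed.

(** The complement is built rather than taken from a splitting of the idempotent [s r]: the local
    summands of [E] are split off [A] one after another. *)
Lemma retract_summand n E A (s : hom E A) (r : hom A E) :
  (forall C, exists m, local_sum m C) -> local_sum n E -> r \oc s = idm E ->
  exists W (j : hom W A) (q : hom A W), biproduct_maps s j r q.
Proof.
move=> sumB; elim: n E A s r => [|n IHn] E A s r /=.
  move=> E0 rs; exists A, (idm A), (idm A); apply: biproduct_mapsI => //.
  - by rewrite comp1m.
  - by rewrite -[s]compm1 E0 compm0 comp0m add0r comp1m.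
move=> [L [E' [locL sE' [i1 [i2 [p1 [p2 [pi1 pi2 p2i1 p1i2 ip]]]]]]]] rs.
have [m sA] := sumB A.
have [|_ [A' [j [q [_ _ bip]]]]] := local_sum_summand (a := s \oc i1) (b := p1 \oc r) locL sA.
  by rewrite compA -(compA p1) rs compm1.
have jq := biproduct_projr bip.
(* [s i2] lands in [A'] because [p1 r] kills it; hence [E'] is a retract of [A']. *)
have jqs : j \oc q \oc (s \oc i2) = s \oc i2.
  by rewrite jq compBl comp1m -!compA (compA r) rs comp1m p1i2 !compm0 subr0.
have rjq : p2 \oc r \oc (j \oc q) = p2 \oc r.
  by rewrite jq compBr compm1 !compA -(compA p2) rs compm1 p2i1 !comp0m subr0.
have [|W [j' [q' bip']]] := IHn E' A' (q \oc s \oc i2) (p2 \oc r \oc j) sE'.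
  by rewrite -!compA (compA j) jqs (compA r) rs comp1m.
have jq' := biproduct_projr bip'.
have [_ qj _ _ _] := bip; have [_ qj' _ _ _] := bip'.
exists W, (j \oc j'), (q' \oc q); apply: biproduct_mapsI => //.
  by rewrite -compA (compA q) qj comp1m.
rewrite -compA (compA j') jq' compBl comp1m compBr jq.
have -> : j \oc (q \oc s \oc i2 \oc (p2 \oc r \oc j) \oc q) = s \oc i2 \oc (p2 \oc r).
  by rewrite -[in RHS]rjq -[in RHS]jqs !compA.
have sr : s \oc r = s \oc i1 \oc (p1 \oc r) + s \oc i2 \oc (p2 \oc r).
  by rewrite -[s in LHS]compm1 -ip compDr compDl !compA.
by rewrite -addrA -opprD -sr [LHS]addrC subrK.
Qed.

(** Orthogonality survives dropping the first member of the family, whereas summing to the identity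
    does not; hence the form of the statement. *)
Lemma orthogonal_family_local_sum n (F : 'I_n -> B) E
    (inj : forall k, hom (F k) E) (prj : forall k, hom E (F k)) :
  (forall k, local_end (F k)) -> (forall k, prj k \oc inj k = idm (F k)) ->
  (forall k l, k <> l -> prj l \oc inj k = 0) ->
  exists P (j : hom P E) (q : hom E P),
    [/\ local_sum n P, q \oc j = idm P & j \oc q = \sum_(k < n) inj k \oc prj k].
Proof.
elim: n F inj prj => [|n IHn] F inj prj locF pi1 pi0.
  have [Z Z0] := has_zero B; exists Z, 0, 0.
  by rewrite big_ord0 /= (proj1 (Z0 Z) (idm Z)) compm0 comp0m.
have [|||P [j [q [sP qj jq]]]] := IHn (fun k => F (lift ord0 k))
    (fun k => inj (lift ord0 k)) (fun k => prj (lift ord0 k)).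
- by move=> k; apply: locF.
- by move=> k; apply: pi1.
- by move=> k l kl; apply: pi0 => /lift_inj.
have [Q [i1 [i2 [p1 [p2 bip]]]]] := has_biproducts (F ord0) P.
have [pi11 pi22 p2i1 p1i2 ip] := bip.
have prj_j : prj ord0 \oc j = 0.
  rewrite -[j]compm1 -qj (compA j) jq compA comp_sumr big1 ?comp0m // => k _.
  by rewrite compA pi0 ?comp0m // => /esym/eqP; rewrite (negPf (neq_lift _ _)).
have q_inj : q \oc inj ord0 = 0.
  rewrite -[q]comp1m -qj -(compA q) jq -compA comp_suml big1 ?compm0 // => k _.
  by rewrite -compA pi0 ?compm0 // => /eqP; rewrite (negPf (neq_lift _ _)).
exists Q, (inj ord0 \oc p1 + j \oc p2), (i1 \oc prj ord0 + i2 \oc q); split.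
- by exists (F ord0), P; split=> //; exists i1, i2, p1, p2.
- rewrite compDl !compDr -!(compA i1) -!(compA i2).
  rewrite 2!(compA (prj ord0)) 2!(compA q).
  by rewrite pi1 prj_j q_inj qj !comp1m !comp0m !compm0 addr0 add0r.
- rewrite big_ord_recl -jq compDl !compDr -!(compA (inj ord0)) -!(compA j).
  rewrite (compA p1) (compA p1) (compA p2) (compA p2) pi11 pi22 p2i1 p1i2.
  by rewrite !comp1m !comp0m !compm0 addr0 add0r.
Qed.

Lemma local_sum_iso n E E' (j : hom E E') (q : hom E' E) :
  q \oc j = idm E -> j \oc q = idm E' -> local_sum n E -> local_sum n E'.
Proof.
case: n => [|n] qj jq /=; first by move=> E0; rewrite -jq -[j]compm1 E0 compm0 comp0m.
move=> [L [E1 [locL sE1 [i1 [i2 [p1 [p2 [pi1 pi2 _ _ ip]]]]]]]].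
exists L, E1; split=> //; exists (j \oc i1), (j \oc i2), (p1 \oc q), (p2 \oc q).
apply: biproduct_mapsI.
- by rewrite -compA (compA q) qj comp1m.
- by rewrite -compA (compA q) qj comp1m.
- by rewrite -!(compA j) -compDr !compA -compDl ip comp1m.
Qed.

Lemma Krull_Schmidt_local_sum E : Krull_Schmidt B -> exists n, local_sum n E.
Proof.
move=> /(_ E)[[n [F [locF [inj [prj [pi1 pi0 sum1]]]]]] _].
have [|P [j [q [sP qj jq]]]] := orthogonal_family_local_sum _ pi1 pi0.
  by move=> k; case: (locF k).
by rewrite sum1 in jq; exists n; apply: local_sum_iso qj jq sP.
Qed.

(** * Conflations under isomorphism, pushout and removal of a common summand *)

Lemma conflation_iso_rev (X Y Z X' Y' Z' : B) (i : hom X Y) (p : hom Y Z)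
    (i' : hom X' Y') (p' : hom Y' Z')
    (a : hom X' X) (b : hom Y' Y) (c : hom Z' Z) :
  is_iso a -> is_iso b -> is_iso c ->
  i \oc a = b \oc i' -> p \oc b = c \oc p' -> conflation i p -> conflation i' p'.
Proof.
move=> [a' [a'a aa']] [b' [b'b bb']] [c' [c'c cc']] bi cp ip.
apply: (conf_iso (exactP B) (a := a') (b := b') (c := c') _ _ _ _ _ ip).
- by exists a.
- by exists b.
- by exists c.
- by rewrite -[b' \oc i]compm1 -aa' -compA (compA i) bi !compA b'b comp1m.
- by rewrite -[c' \oc p]compm1 -bb' -compA (compA p) cp !compA c'c comp1m.
Qed.

(** Pushouts are unique up to isomorphism, so the given square is compared with the one from
    [push_exists], which carries a conflation. *)
Lemma conflation_pushout E K C K' E' (i : hom K E) (p : hom E C) (a : hom K K')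
    (b : hom E E') (i' : hom K' E') (p' : hom E' C) :
  conflation i p -> is_pushout i a b i' -> p' \oc b = p -> p' \oc i' = 0 ->
  conflation i' p'.
Proof.
move=> ip [bi up] p'b p'i'.
have [[D k d kd] /= [c [[/= ck uc] dc]]] := push_exists a (Extension ip).
rewrite /= in c ck uc dc.
have [[dk _] _] := conf_kc (exactP B) kd.
have [w [[wc wk] _]] := uc _ _ _ bi.
have [v [[vb vi'] _]] := up _ _ _ ck.
have ext W (s s' : hom E' W) : s \oc b = s' \oc b -> s \oc i' = s' \oc i' -> s = s'.
  move=> sb si; have [|z [_ zu]] := up _ (s \oc b) (s \oc i').
    by rewrite -!compA bi.
  by rewrite -(zu s) // (zu s').
have ext' W (s s' : hom D W) : s \oc c = s' \oc c -> s \oc k = s' \oc k -> s = s'.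
  move=> sb si; have [|z [_ zu]] := uc _ (s \oc c) (s \oc k).
    by rewrite -!compA ck.
  by rewrite -(zu s) // (zu s').
apply: (conf_iso (exactP B) (a := idm K') (b := w) (c := idm C) _ _ _ _ _ kd).
- exact: is_iso_id.
- exists v; split.
  + by apply: ext'; rewrite comp1m -compA ?wc ?wk.
  + by apply: ext; rewrite comp1m -compA ?vb ?vi'.
- exact: is_iso_id.
- by rewrite compm1.
- by rewrite comp1m; apply: ext'; rewrite -compA ?wc ?wk ?p'b ?p'i'.
Qed.

(** As [L] sits compatibly in [K] and [E], pushing [i] out along [qK], which kills [L] in [K],
    amounts to killing [L] in [E], and this leaves [E']. *)
Lemma conflation_remove_summand E E' K K' C L (i : hom K E) (p : hom E C)
    (t : hom L K) (tK : hom K' K) (rK : hom K L) (qK : hom K K')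
    (j : hom E' E) (r : hom E L) (q : hom E E') :
  conflation i p -> biproduct_maps t tK rK qK ->
  biproduct_maps (i \oc t) j r q -> r \oc i = rK ->
  conflation (q \oc i \oc tK) (p \oc j).
Proof.
move=> ip bipK bipE ri.
have [[pi0 _] _] := conf_kc (exactP B) ip.
have eK := biproduct_projr bipK; have eE := biproduct_projr bipE.
have [_ qtK qKt _ _] := bipK; have [_ qj qit _ _] := bipE.
have pjq : p \oc j \oc q = p.
  by rewrite -compA eE compBr compm1 !compA pi0 !comp0m subr0.
apply: (conflation_pushout (a := qK) (b := q) ip) => //.
- split.
    rewrite -[RHS]compA eK compBr compm1 !compA.
    by rewrite -(compA q) qit comp0m subr0.
  move=> W u v uv; exists (u \oc j); split.
    have ut : u \oc (i \oc t) = 0 by rewrite compA uv -compA qKt compm0.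
    have ujq : u \oc j \oc q = u.
      by rewrite -compA eE compBr compm1 compA ut comp0m subr0.
    by rewrite !compA ujq uv -compA qtK compm1.
  by move=> w [<- _]; rewrite -compA qj compm1.
- by rewrite !compA pjq pi0 comp0m.
Qed.

(** * Approximation conflations from an endomorphism that factors through [X] *)

Lemma approximation n E K C (X Y : B -> Prop) (i : hom K E) (p : hom E C)
    (f : hom E E) :
  (forall A, exists m, local_sum m A) -> summand_closed X -> summand_closed Y ->
  local_sum n E -> conflation i p -> Y K -> factor_class X f -> p \oc f = p ->
  exists YC XC (i' : hom YC XC) (p' : hom XC C),
    [/\ conflation i' p', X XC & Y YC].
Proof.
move=> sumB sumX sumY.
elim/ltn_ind: n E K i p f => n IHn E K i p f sE ip YK [Z [g [h [XZ fgh]]]] pf.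
have [[w [wf _]]|nisof] := pselect (is_iso f).
  exists K, E, i, p; split=> //.
  have [|W [j [q bip]]] := retract_summand (s := h) (r := w \oc g) sumB sE.
    by rewrite -compA -fgh.
  by apply: sumX XZ; exists h, j, (w \oc g), q; exact: bip.
have [L [a [b [locL [w [wba _]]]]]] : exists L (a : hom L E) (b : hom E L),
    local_end L /\ is_iso (b \oc (idm E - f) \oc a).
  apply: contrapT => nex; apply: nisof.
  rewrite -[f](subKr (idm E)); apply: radical_iso sE _ => L a b locL isoL.
  by apply: nex; exists L, a, b.
have [[pi0 keri] _] := conf_kc (exactP B) ip.
have [|t [it _]] := keri _ ((idm E - f) \oc a).
  by rewrite compA compBr compm1 pf subrr comp0m.
(* The retraction [w b] of [i t] restricts to the retraction [w b i] of [t], so the projections of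
   [E] and [K] onto [L] are compatible. *)
have rit : w \oc b \oc (i \oc t) = idm L by rewrite it -wba !compA.
have [m [E' [j [q [nm sE' bip]]]]] := local_sum_summand locL sE rit.
have [mK sK] := sumB K.
have [|_ [K' [tK [qK [_ _ bipK]]]]] :=
    local_sum_summand (a := t) (b := w \oc b \oc i) locL sK.
  by rewrite -compA.
have eE := biproduct_projr bip.
have pjq : p \oc j \oc q = p.
  by rewrite -compA eE compBr compm1 !compA pi0 !comp0m subr0.
(* The compression [q f j] still factors through [Z], and it lies over [C] because [p j q = p]. *)
apply: (IHn m _ E' K' (q \oc i \oc tK) (p \oc j) (q \oc f \oc j)) => //.
- by rewrite nm.
- exact: conflation_remove_summand ip bipK bip _.
- by apply: sumY YK; exists tK, t, qK, (w \oc b \oc i); apply: biproduct_mapsC.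
- by exists Z, (q \oc g), (h \oc j); rewrite fgh !compA.
- by rewrite !compA pjq pf.
Qed.

(* Stated with a mere morphism of extensions [d -> dk] so that, in the opposite
   category, it also covers classes that are pullbacks. *)
Lemma precover_approximation (X Y : B -> Prop) C K A
    (dk : extension C K) (d : extension C A) (h : hom A K)
    (b : hom (mid d) (mid dk)) :
  (forall E, exists m, local_sum m E) -> summand_closed X -> summand_closed Y ->
  (forall Z W E (i : hom W E) (p : hom E Z),
    X Z -> Y W -> conflation i p -> exists s, p \oc s = idm Z) ->
  b \oc infl d = infl dk \oc h -> defl dk \oc b = defl d ->
  factor_class Y h -> factor_class X (defl dk) ->
  exists YC XC (i : hom YC XC) (p : hom XC C),
    [/\ conflation i p, X XC & Y YC].
Proof.
move=> sumB sumX sumY split_XY bi pb [W [g [h' [YW hE]]]] [Z [f1 [f2 [XZ fE]]]].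
(* Pushing out along the first factor [h'] of [h] puts the kernel [W] in [Y]. *)
have [d1 [b1 [[b1i up1] p1b1]]] := push_exists h' d.
have [|m [[mb1 mi1] _]] := up1 _ b (infl dk \oc g).
  by rewrite bi hE compA.
have [[p1i1 _] _] := conf_kc (exactP B) (extP d1).
have [[pi _] _] := conf_kc (exactP B) (extP dk).
have pm : defl dk \oc m = defl d1.
  have [|z [_ zu]] := up1 _ (defl d) (0 : hom W C).
    have [[pi0 _] _] := conf_kc (exactP B) (extP d).
    by rewrite pi0 comp0m.
  rewrite -(zu (defl dk \oc m)) ?(zu (defl d1)) //.
  by split; rewrite -compA ?mb1 // mi1 compA pi comp0m.
(* The pullback along [f1] has ends in [X] and [Y], so it splits and [b2 s] lifts [f1] to [mid d1];
   following [f2 m] by this lift gives the endomorphism over [C]. *)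
have [d2 [b2 [[p1b2 _] _]]] := pull_exists f1 d1.
have [s p2s] := split_XY _ _ _ _ _ XZ YW (extP d2).
have [n sE] := sumB (mid d1).
apply: (approximation (f := b2 \oc s \oc (f2 \oc m)) sumB sumX sumY sE (extP d1)) => //.
- by exists Z, (b2 \oc s), (f2 \oc m).
- by rewrite !compA p1b2 -(compA f1) p2s compm1 -fE.
Qed.

End Krull_Schmidt.

(** * The opposite exact category *)

Definition op_additive (B : Defs.additive) : Defs.additive.
Proof.
exists (op_preadditive B).
- by have [Z Z0] := has_zero B; exists Z => A; have [? ?] := Z0 A.
- move=> A C; have [P [i1 [i2 [p1 [p2 bip]]]]] := has_biproducts A C.
  by exists P, p1, p2, i1, i2; case: bip.
Defined.

Lemma is_iso_op (B : Defs.additive) (A C : B) (f : hom A C) :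
  is_iso f <-> @is_iso (op_additive B) C A f.
Proof. by split=> -[g [? ?]]; exists g. Qed.

Lemma op_exact_structure (B : exact_category) :
  @exact_structure (op_additive B) (fun A C E i p => @conflation B E C A p i).
Proof.
split.
- by move=> A C E i p /(conf_kc (exactP B))[].
- move=> A C E A' C' E' i p i' p' a b c ia ib ic bi cp ip.
  by apply: (conflation_iso_rev (a := c) (b := b) (c := a) _ _ _ _ _ ip);
    rewrite -?[is_iso _]is_iso_op //; exact/is_iso_op.
- by move=> A; have [E [p ?]] := defl_id (exactP B) A; exists E, p.
- by move=> A; have [E [p ?]] := infl_id (exactP B) A; exists E, p.
- by move=> A C E j i di dj; apply: (defl_comp (exactP B)).
- by move=> A C E j i di dj; apply: (infl_comp (exactP B)).
- move=> A C A' i a di.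
  by have [E [b [i' [po ii']]]] := defl_pullback (exactP B) a di; exists E, b, i'.
- move=> A C A' i a di.
  by have [E [b [i' [po ii']]]] := infl_pushout (exactP B) a di; exists E, b, i'.
Qed.

Definition op_exact (B : exact_category) : exact_category :=
  ExactCategory (op_exact_structure B).

Lemma local_sum_op (B : exact_category) n (E : B) :
  local_sum n E -> @local_sum (op_exact B) n E.
Proof.
elim: n E => // n IHn E /= [L [E' [[L0 locL] sE' [i1 [i2 [p1 [p2 bip]]]]]]].
exists L, E'; split; [split=> // f g fg | exact: IHn | ].
- have [|isof|isog] := locL f g; first exact/is_iso_op.
  + by left; apply/is_iso_op.
  + by right; apply/is_iso_op.
- by exists p1, p2, i1, i2; case: bip.
Qed.

Lemma summand_closed_op (B : exact_category) (X : B -> Prop) :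
  summand_closed X -> @summand_closed (op_exact B) X.
Proof.
move=> sumX A1 A2 A [i1 [i2 [p1 [p2 bip]]]]; apply: (sumX A1 A2 A).
by exists p1, p2, i1, i2; case: bip.
Qed.

(** * Split conflations, and the passage from ideals to objects *)

Lemma conflation_retraction (B : exact_category) (A E C : B)
    (i : hom A E) (p : hom E C) (s : hom C E) :
  conflation i p -> p \oc s = idm C -> exists r, r \oc i = idm A.
Proof.
move=> ip ps; have [[pi0 keri] _] := conf_kc (exactP B) ip.
have [|r [ir _]] := keri _ (idm E - s \oc p).
  by rewrite compBr compm1 compA ps comp1m subrr.
exists r; have [z [_ zu]] := keri _ i pi0.
rewrite -(zu (idm A)) ?compm1 // -(zu (r \oc i)) //.
by rewrite compA ir compBl comp1m -compA pi0 compm0 subr0.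
Qed.

(** Identities of objects of [X] and [Y] lie in the two ideals, so this turns orthogonality of the
    ideals into vanishing of [Ext1] on objects. *)
Lemma Ext1map_id (B : exact_category) (C A : B) (x : Ext1 C A) :
  Ext1map (idm C) (idm A) x = x.
Proof.
rewrite -[x]ext_reprK; set d := ext_repr x.
rewrite /Ext1map (pullE (d' := d)) ?(pushE (d' := d)) //.
- exists (idm _); split; last by rewrite compm1.
  split=> [|W u v]; first by rewrite comp1m compm1.
  rewrite compm1 => uv; exists u; split=> [|w [<- _]]; by rewrite ?compm1.
- exists (idm _); split; last by rewrite comp1m.
  split=> [|W u v]; first by rewrite comp1m compm1.
  rewrite comp1m => uv; exists u; split=> [|w [<- _]]; by rewrite ?comp1m.
Qed.

Theorem corollary3p12 (B : exact_category) (HKS : Krull_Schmidt B)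
    (X Y : B -> Prop)
    (* subcategories are closed under isomorphisms and direct summands *)
    (isoX : iso_closed X) (sumX : summand_closed X)
    (isoY : iso_closed Y) (sumY : summand_closed Y) :
  complete_ideal_cotorsion_pair (factor_class X) (factor_class Y) ->
  complete_cotorsion_pair X Y.
Proof.
case=> -[_ _ rperp lperp] precov preenv.
have sumB E := Krull_Schmidt_local_sum E HKS.
have factor_id (D : B -> Prop) A : D A -> factor_class D (idm A).
  by move=> DA; exists A, (idm A), (idm A); rewrite comp1m.
have ext0 C A : X C -> Y A -> forall x : Ext1 C A, x = Ext1_zero C A.
  move=> XC YA x; rewrite -[x]Ext1map_id.
  by apply: (proj2 (rperp _ _ _) (factor_id Y A YA)); apply: factor_id.
have section_XY Z W E (i : hom W E) (p : hom E Z) :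
    X Z -> Y W -> conflation i p -> exists s, p \oc s = idm Z.
  by move=> XZ YW ip; apply/(Ext1_zeroP (Extension ip))/ext0.
split=> // C.
- have [X0 [f [Xf [K [k [kf [A [l [h [rh]]]]]]]]]] := precov C.
  have [d2 hd2] := push_exists h (ext_repr l).
  have [b [[bi _] pb]] := hd2.
  (* On representatives the equality of classes yields a morphism of extensions [c b] that is [h] on
     kernels and the identity on [C]. *)
  rewrite -{1}[l]ext_reprK (pushE hd2) => /esym/ext_classP[c [_ ci pc]].
  apply: (precover_approximation (dk := Extension kf) (d := ext_repr l)
    (h := h) (b := c \oc b) sumB sumX sumY section_XY) => //.
  + by rewrite -compA bi compA ci.
  + by rewrite compA pc pb.
  + exact/rperp.
- have [Y0 [g [Yg [K [k [gk [D [l [h [lh]]]]]]]]]] := preenv C.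
  have [d2 hd2] := pull_exists h (ext_repr l).
  have [b [[pb _] bi]] := hd2.
  rewrite -{1}[l]ext_reprK (pullE hd2) => /ext_classP[c [_ ci pc]].
  have factor_op (U : B -> Prop) P Q (u : hom P Q) :
      factor_class U u -> @factor_class (op_exact B) U Q P u.
    by move=> [Z [u1 [u2 [UZ ->]]]]; exists Z, u2, u1.
  (* In the opposite category the preenvelope is a precover, [X] and [Y] trade places, and [b c]
     runs from the representative of [l] to the given conflation. *)
  have [||||||||XC [YC [p [i [ip YYC XXC]]]]] :=
    @precover_approximation (op_exact B) Y X C K D
      (@Extension (op_exact B) C K Y0 k g gk)
      (@Extension (op_exact B) C D (mid (ext_repr l)) (defl (ext_repr l))
         (infl (ext_repr l)) (extP (ext_repr l))) h (b \oc c).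
  + by move=> E; have [n sE] := sumB E; exists n; apply: local_sum_op.
  + exact: summand_closed_op.
  + exact: summand_closed_op.
  (* A section in the opposite category is a retraction of the inflation in [B]. *)
  + move=> Z W E i p YZ XW ip.
    have [s ps] := section_XY _ _ _ _ _ XW YZ ip.
    exact: (@conflation_retraction B Z E W p i s).
  + by rewrite /= compA pb -compA pc.
  + by rewrite /= -compA ci bi.
  + exact/factor_op/lperp.
  + exact: factor_op.
  by exists YC, XC, i, p.
Qed.
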